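(* Let $\theta\in[0,\pi/2)$, $\mathbf{p}=(\cos\theta,\sin\theta)$ and $C_\theta=\cos\theta+\sin\theta$. Let $X=\{\mathbf{x}_j\}_{j=1}^n$ be independent random variables drawn from a probability distribution on $\mathcal{E}_K$ whose density $\xi$ satisfies $0<C_{\xi,l}\le\xi(\mathbf{x})\le C_{\xi,u}$ for all $\mathbf{x}\in\mathcal{E}_K$. Suppose that the sequence $\{\mathcal{R}_{\mathbf{p}}\varphi(\cdot-\mathbf{p}\cdot\mathbf{k}_l)\}_{l=1}^{\mathcal{Q}}$ is linearly independent. Then there exist constants $0<C_{1,\mathbf{p}}\le C_{2,\mathbf{p}}<\infty$ such that, for every $\gamma$ with $0<\gamma<\frac{2KC_{1,\mathbf{p}}C_{\xi,l}}{M_2^2}$, with probability at least $1-\epsilon_{\mathcal{Q}}$, where $$\epsilon_{\mathcal{Q}}=\mathcal{Q}\exp\left(-\frac{nm_2^4\gamma^2}{8K^2C_\theta^2M_2^2\left[4K^2C_\theta^2C_\varphi^2C_{\xi,u}+\frac{\gamma\left(C_\varphi^2+C_{\xi,u}m_2^2\right)}{3}\right]}\right),$$ the matrix $U^{\mathrm{T}}U$ is invertible and the reconstruction formula $$f(\mathbf{x})=\sum_{j=1}^n\mathcal{R}_{\mathbf{p}}(f(\mathbf{x}_j))\,\Upsilon_j(\mathbf{x}),\qquad\forall\,\mathbf{x}\in\mathcal{E}_K,$$ holds for all $f\in\mathcal{S}_{N,K}(\varphi)$, where $U$ is the $n\times\mathcal{Q}$ matrix with $(j,l)$ entry $\mathcal{R}_{\mathbf{p}}(\varphi(\mathbf{x}_j-\mathbf{k}_l))$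 and $$\Upsilon_j(\mathbf{x})=\sum_{l=1}^{\mathcal{Q}}\sum_{i=1}^{\mathcal{Q}}\mathcal{R}_{\mathbf{p}}(\varphi(\mathbf{x}_j-\mathbf{k}_i))\left((U^{\mathrm{T}}U)^{-1}\right)_{il}\varphi(\mathbf{x}-\mathbf{k}_l).$$
   Context: $N,K>0$ are fixed, $\mathcal{E}_K=[-K,K]^2$, $E=\left[\lceil -N-K\rceil,\lfloor K+N\rfloor\right]^2\cap\mathbb{Z}^2=\{\mathbf{k}_1,\ldots,\mathbf{k}_{\mathcal{Q}}\}$ with $\mathcal{Q}$ the cardinality of $E$, and it is assumed throughout that $\mathcal{Q}>1$. The generator $\varphi:\mathbb{R}^2\to\mathbb{R}$ is continuous with compact support contained in $[-N,N]^2$ and has stable shifts: there are constants $0<m_2\le M_2<\infty$ such that for every $C=(c_{\mathbf{k}_l})_{l=1}^{\mathcal{Q}}$, $$m_2\|C\|_{\ell^2}\le\Big\|\sum_{l=1}^{\mathcal{Q}}c_{\mathbf{k}_l}\varphi(\cdot-\mathbf{k}_l)\Big\|_{L^2(\mathcal{E}_K)}\le M_2\|C\|_{\ell^2}.$$ The signal space is $$\mathcal{S}_{N,K}(\varphi)=\Big\{f:\ f(\mathbf{x})=\sum_{l=1}^{\mathcal{Q}}c_{\mathbf{k}_l}\varphi(\mathbf{x}-\mathbf{k}_l),\ c_{\mathbf{k}_l}\in\mathbb{R},\ \mathbf{x}\in\mathcal{E}_K\Big\}.$$ Also $C_\varphi=\sup_{\mathbf{x}\in\mathcal{E}_K}\sum_{l=1}^{\mathcal{Q}}|\varphi(\mathbf{x}-\mathbf{k}_l)|$.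 Radon transform: for $g:\mathbb{R}^2\to\mathbb{R}$, $$\mathcal{R}_{\mathbf{p}}g(t)=\int_{-\infty}^{\infty}g(t\cos\theta-s\sin\theta,\,t\sin\theta+s\cos\theta)\,ds,\quad t\in\mathbb{R}.$$ The notation $\mathcal{R}_{\mathbf{p}}(g(\mathbf{x}))$ means $\mathcal{R}_{\mathbf{p}}g(\mathbf{p}\cdot\mathbf{x})$; in particular $\mathcal{R}_{\mathbf{p}}(\varphi(\mathbf{x}_j-\mathbf{k}_l))=\mathcal{R}_{\mathbf{p}}\varphi(\mathbf{p}\cdot\mathbf{x}_j-\mathbf{p}\cdot\mathbf{k}_l)$. For $f=\sum_l c_{\mathbf{k}_l}\varphi(\cdot-\mathbf{k}_l)\in\mathcal{S}_{N,K}(\varphi)$, the Radon transform is taken of this finite sum, so $\mathcal{R}_{\mathbf{p}}(f(\mathbf{x}))=\sum_{l=1}^{\mathcal{Q}}c_{\mathbf{k}_l}\mathcal{R}_{\mathbf{p}}(\varphi(\mathbf{x}-\mathbf{k}_l))$.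
   Formalization: Linear independence of the functions R_pφ(·−p·k_l) is required on {p·x : x in E_K}, the set where they are sampled, not on all of R; with independence only on R, a column of U can vanish identically and the claim fails for large n. *)

(* Defs.v *)
From mathcomp Require Import all_boot all_order all_algebra.
From mathcomp Require Import all_classical all_reals all_analysis.

Set Implicit Arguments.
Unset Strict Implicit.
Unset Printing Implicit Defensive.

Import Order.TTheory GRing.Theory Num.Theory.
Import numFieldNormedType.Exports.

Local Open Scope classical_set_scope.
Local Open Scope ring_scope.

(* [R * R] with the Borel sigma-algebra that carries [lebesgue_measure]; the
   two types are convertible but their measurable structures have different
   displays. *)
Notation plane R := (measurableTypeR R * measurableTypeR R)%type.

Notation lebesgue2 R := (@lebesgue_measure R \x @lebesgue_measure R)%E.

Section Plane.
Context {R : realType}.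

Definition square (K : R) : set (R * R) :=
  [set x | (- K <= x.1 <= K) /\ (- K <= x.2 <= K)].

Definition dotp (x y : R * R) : R := x.1 * y.1 + x.2 * y.2.

Definition zpoint (z : int * int) : R * R := (z.1%:~R, z.2%:~R).

Definition shift_set (N K : R) : set (int * int) :=
  [set z | (Num.ceil (- N - K) <= z.1 <= Num.floor (K + N))
        /\ (Num.ceil (- N - K) <= z.2 <= Num.floor (K + N))].

Definition compact_support_in (phi : R * R -> R) (A : set (R * R)) : Prop :=
  let S := closure [set x | phi x != 0] in compact S /\ S `<=` A.

Definition L2norm_on (D : set (R * R)) (f : R * R -> R) : \bar R :=
  Lnorm (lebesgue2 R) 2%:E (EFin \o (f \_ D)).

Definition l2norm (Q : nat) (c : 'I_Q -> R) : R :=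
  Num.sqrt (\sum_(l < Q) c l ^+ 2).

End Plane.

Section SignalSpace.
Context {R : realType} (K : R) (phi : R * R -> R).
Context (Q : nat) (k : 'I_Q -> int * int).

Definition shift_sum (c : 'I_Q -> R) (x : R * R) : R :=
  \sum_(l < Q) c l * phi (x - zpoint (k l)).

Definition stable_shifts (m2 M2 : R) : Prop :=
  forall c : 'I_Q -> R,
    ((m2 * l2norm c)%:E <= L2norm_on (square K) (shift_sum c))%E /\
    (L2norm_on (square K) (shift_sum c) <= (M2 * l2norm c)%:E)%E.

(* Only the values of [f] on the square matter; the Radon transform of [f] is
   by convention that of the whole sum [shift_sum c]. *)
Definition represents (c : 'I_Q -> R) (f : R * R -> R) : Prop :=
  forall x, square K x -> f x = shift_sum c x.

Definition signal_space : set (R * R -> R) :=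
  [set f | exists c, represents c f].

Definition Cphi : R :=
  sup [set \sum_(l < Q) `|phi (x - zpoint (k l))| | x in square K].

End SignalSpace.

Section RadonTransform.
Context {R : realType} (theta : R).

Definition direction : R * R := (cos theta, sin theta).

Definition radon (g : R * R -> R) (t : R) : R :=
  (\int[@lebesgue_measure R]_s
     g (t * cos theta - s * sin theta, t * sin theta + s * cos theta))%R.

Definition radon_shift (phi : R * R -> R) (z : int * int) (t : R) : R :=
  radon phi (t - dotp direction (zpoint z)).

Definition sample_matrix (phi : R * R -> R) (Q : nat) (k : 'I_Q -> int * int)
    (n : nat) (x : 'I_n -> R * R) : 'M[R]_(n, Q) :=
  \matrix_(j < n, l < Q) radon_shift phi (k l) (dotp direction (x j)).

Definition Upsilon (phi : R * R -> R) (Q : nat) (k : 'I_Q -> int * int)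
    (n : nat) (x : 'I_n -> R * R) (j : 'I_n) (y : R * R) : R :=
  let U := sample_matrix phi k x in
  \sum_(l < Q) \sum_(i < Q)
    radon_shift phi (k i) (dotp direction (x j)) *
    invmx (U^T *m U) i l * phi (y - zpoint (k l)).

End RadonTransform.

(* Linear independence of the restrictions to [D].  For shifts of a Radon
   transform [D] is the set of values of [dotp p x], [x] in the square:
   independence over the whole line would allow a column of the sample matrix
   to vanish identically. *)
Definition lin_indep_on {R : realType} (D : set R) (Q : nat)
    (g : 'I_Q -> R -> R) : Prop :=
  forall c : 'I_Q -> R,
    (forall t, D t -> \sum_(l < Q) c l * g l t = 0) -> forall l, c l = 0.

Section Sampling.
Context {R : realType} (d : measure_display) (T : measurableType d).
Context (P : probability T R).

Definition independent_rvs (n : nat) (X : 'I_n -> {RV P >-> plane R}) :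
    Prop :=
  forall (J : {set 'I_n}) (B : 'I_n -> set (plane R)),
    (forall j, measurable (B j)) ->
    P (\bigcap_(j in [set` J]) (X j @^-1` B j)) =
    (\prod_(j in J) P (X j @^-1` B j))%E.

Definition has_density_on (D : set (plane R)) (xi : plane R -> R)
    (Y : {RV P >-> plane R}) : Prop :=
  measurable_fun D xi /\
  forall B : set (plane R), measurable B ->
    distribution P Y B = (\int[lebesgue2 R]_(x in B `&` D) (xi x)%:E)%E.

Definition with_probability_at_least (a : R) (G : set T) : Prop :=
  exists A : set T, [/\ measurable A, A `<=` G & (a%:E <= P A)%E].

End Sampling.

Definition epsilonQ {R : realType} (Q n : nat)
    (K Ctheta m2 M2 Cp Cxiu gamma : R) : R :=
  Q%:R * expR (- (n%:R * m2 ^+ 4 * gamma ^+ 2 /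
    (8 * K ^+ 2 * Ctheta ^+ 2 * M2 ^+ 2 *
      (4 * K ^+ 2 * Ctheta ^+ 2 * Cp ^+ 2 * Cxiu +
       gamma * (Cp ^+ 2 + Cxiu * m2 ^+ 2) / 3)))).

(* Main.v *)
Require Import Defs.
From mathcomp Require Import all_boot all_order all_algebra.
From mathcomp Require Import all_classical all_reals all_analysis.
From mathcomp Require Import perm measurable_realfun ring lra.

Import Order.TTheory GRing.Theory Num.Theory.
Import numFieldNormedType.Exports.

Local Open Scope classical_set_scope.
Local Open Scope ring_scope.

(* Invertibility of [U^T U] only needs [U] to have full column rank, and since
   [C1] may be chosen small no matrix concentration inequality is required.  By
   linear independence there are points [x_1, ..., x_Q] of the square at which
   the square sample matrix is invertible; by continuity of the Radon transform
   it remains so when each [x_i] moves in a box [B_i] of side [r].  So [U] has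
   full rank as soon as every [B_i] contains a sample.  A given [B_i] is missed
   by all the samples with probability at most [(1 - Cxil r^2)^n], hence some
   box is missed with probability at most [Q exp(- n Cxil r^2)], and [C1] is
   chosen so that the exponent of [epsilonQ] is at most [n Cxil r^2]. *)

(** * Translation invariance of the Lebesgue integral on the line *)

Section Translation.
Context {R : realType} (a : R).

Let tr : measurableTypeR R -> measurableTypeR R := fun s => s - a.

Let mtr : measurable_fun setT tr. Proof. exact: measurable_funB. Qed.

(** Lebesgue measure is determined by its values on half-open intervals, and a translation preserves
    their length. *)
Lemma lebesgue_measure_translate (A : set R) : measurable A ->
  pushforward (@lebesgue_measure R)
    ((fun s => s - a) : _ -> measurableTypeR R) A = lebesgue_measure A.
Proof.
move=> mA; apply/esym/lebesgue_measure_unique => //= _ [[u v] _ <-].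
rewrite /pushforward.
have -> : tr @^-1` `]u, v]%classic = `]u + a, v + a]%classic.
  by apply/seteqP; split => s /=; rewrite !in_itv /= /tr ltrBrDr lerBlDr.
rewrite !lebesgue_measure_itv /= !lte_fin ltrD2r; case: ifP => // _.
by rewrite -!EFinB; congr EFin; ring.
Qed.

Lemma integrable_translate (f : R -> R) :
  (@lebesgue_measure R).-integrable setT (EFin \o f) ->
  (@lebesgue_measure R).-integrable setT (EFin \o (fun s => f (s - a))).
Proof.
move=> /integrableP[mf foo]; apply/integrableP; split.
  exact: (measurableT_comp mf mtr).
rewrite -[X in integral _ X _](preimage_setT tr).
rewrite -(@ge0_integral_pushforward _ _ _ _ _ _ mtr (@lebesgue_measure R) setT
  (fun s => `|(f s)%:E|%E))//; last exact: measurableT_comp.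
rewrite (eq_measure_integral (@lebesgue_measure R))//= => A mA _.
exact: lebesgue_measure_translate.
Qed.

Lemma Rintegral_translate (f : R -> R) :
  (@lebesgue_measure R).-integrable setT (EFin \o f) ->
  (\int[@lebesgue_measure R]_s f (s - a))%R =
  (\int[@lebesgue_measure R]_s f s)%R.
Proof.
move=> If; rewrite /Rintegral; congr fine.
have /integrableP[mf _] := If.
have := @integral_pushforward _ _ _ _ _ _ mtr (@lebesgue_measure R) setT
  (EFin \o f) mf.
rewrite preimage_setT => /(_ (integrable_translate f If) measurableT) <-.
by apply: eq_measure_integral => //= A mA _; exact: lebesgue_measure_translate.
Qed.

End Translation.

(** * Continuity, shift rule and linearity of the Radon transform *)

Section RadonRegularity.
Context {R : realType} (N : R) (phi : R * R -> R) (theta : R).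
Context (phi_cont : continuous phi).
Context (phi_supp : compact_support_in phi (square N)).

Let line (t s : R) : R * R :=
  (t * cos theta - s * sin theta, t * sin theta + s * cos theta).

Lemma support_square (x : R * R) : phi x != 0 -> square N x.
Proof. by move=> px; apply: phi_supp.2; apply: subset_closure. Qed.

Lemma compact_support_bounded : exists M, forall x, `|phi x| <= M.
Proof.
have [cS _] := phi_supp.
have [M0 [_ /(_ (M0 + 1))]] :=
  compact_bounded (continuous_compact (continuous_subspaceT phi_cont) cS).
rewrite ltrDl ltr01 => /(_ isT) bM.
exists (Num.max 0 (M0 + 1)) => x.
have [->|px] := eqVneq (phi x) 0; first by rewrite normr0 le_max lexx.
rewrite le_max; apply/orP; right; apply: bM; exists x => //.
exact: subset_closure.
Qed.

(** [s] is the coordinate of [line t s] along the unit vector [(- sin theta, cos theta)], so on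
    [square N] it is at most [N * (|sin theta| + |cos theta|)] in absolute value. *)
Lemma line_support (t s : R) : phi (line t s) != 0 -> - (2 * N) <= s <= 2 * N.
Proof.
move=> /support_square[]; rewrite /line /= => /andP[h1 h2] /andP[h3 h4].
have Es : s = (t * sin theta + s * cos theta) * cos theta -
             (t * cos theta - s * sin theta) * sin theta.
  by rewrite -[LHS]mulr1 -(cos2Dsin2 theta); ring.
move: h1 h2 h3 h4; rewrite [X in _ <= X <= _]Es.
set a := _ - _; set b := _ + _ => h1 h2 h3 h4.
have := cos_le1 theta; have := cos_geN1 theta.
have := sin_le1 theta; have := sin_geN1 theta => *.
by apply/andP; split; nra.
Qed.

Lemma line_continuousl (s : R) : continuous (fun t => phi (line t s)).
Proof.
move=> t; apply: continuous_comp; last exact: phi_cont.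
apply: (cvg_pair (G := nbhs _) (H := nbhs _)).
  by apply: cvgB; [apply: cvgMl; exact: cvg_id|exact: cvg_cst].
by apply: cvgD; [apply: cvgMl; exact: cvg_id|exact: cvg_cst].
Qed.

Lemma line_continuousr (t : R) : continuous (fun s => phi (line t s)).
Proof.
move=> s; apply: continuous_comp; last exact: phi_cont.
apply: (cvg_pair (G := nbhs _) (H := nbhs _)).
  by apply: cvgB; [exact: cvg_cst|apply: cvgMl; exact: cvg_id].
by apply: cvgD; [exact: cvg_cst|apply: cvgMl; exact: cvg_id].
Qed.

(** An integrable majorant of [s |-> phi (line t s)] that is the same for all [t], as dominated
    convergence requires. *)
Let dom (M : R) : R -> R := (fun=> M) \_ `[- (2 * N), 2 * N].

Let dom_bound M : (forall x, `|phi x| <= M) ->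
  forall t s, `|phi (line t s)| <= dom M s.
Proof.
move=> bM t s; rewrite /dom patchE; case: ifPn => [_|]; first exact: bM.
rewrite notin_setE /= in_itv /= => ns.
have [->|/line_support//] := eqVneq (phi (line t s)) 0.
by rewrite normr0.
Qed.

Let dom_integrable M :
  (@lebesgue_measure R).-integrable setT (EFin \o dom M).
Proof.
have := @integrable_mkcond _ _ _ (@lebesgue_measure R)
  `[- (2 * N), 2 * N]%classic (EFin \o (fun=> M)) (measurable_itv _).
rewrite restrict_EFin => <-.
apply: continuous_compact_integrable; first exact: segment_compact.
by apply: continuous_subspaceT => x; exact: cvg_cst.
Qed.

Lemma line_integrable (t : R) :
  (@lebesgue_measure R).-integrable setT (EFin \o (fun s => phi (line t s))).
Proof.
have [M bM] := compact_support_bounded.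
apply: (le_integrable measurableT _ _ (dom_integrable M)).
  apply/measurable_EFinP; apply: continuous_measurable_fun.
  exact: line_continuousr.
move=> s _ /=; rewrite lee_fin (le_trans (dom_bound M bM t s))//.
exact: ler_norm.
Qed.

Lemma radon_continuous : continuous (radon theta phi).
Proof.
have [M bM] := compact_support_bounded.
move=> t.
(* Continuity at [t] is local, so any open interval around [t] will do. *)
have := @continuity_under_integral R _ _ (@lebesgue_measure R)
  (fun t s => phi (line t s)) setT measurableT (t - 1) (t + 1)
  (fun x _ => line_integrable x) _ (dom M) (dom_integrable M) _.
apply.
- by apply: aeW => s _ u _; exact: line_continuousl.
- by move=> u _; apply: aeW => s _; exact: dom_bound.
- by rewrite inE /= in_itv /=; apply/andP; split; lra.
Qed.

(** In the orthonormal frame formed by [direction theta] and its normal, subtracting [z] shifts each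
    coordinate of the point by the matching coordinate of [z]. *)
Let line_translate (z : R * R) (t s : R) :
  line t s - z =
  line (t - dotp (direction theta) z) (s - (z.2 * cos theta - z.1 * sin theta)).
Proof.
case: z => z1 z2; rewrite /line /dotp /direction /=.
(* The factors [1] are there to be replaced by [cos^2 + sin^2], which turns the claim into a ring
   identity. *)
rewrite (_ : (_, _) - _ = (t * cos theta - s * sin theta - z1 * 1,
  t * sin theta + s * cos theta - z2 * 1)); last by rewrite !mulr1.
by rewrite -!(cos2Dsin2 theta); congr pair; ring.
Qed.

Lemma line_translate_integrable (z : R * R) (t : R) :
  (@lebesgue_measure R).-integrable setT
    (EFin \o (fun s => phi (line t s - z))).
Proof.
under [X in EFin \o X]eq_fun do rewrite line_translate.
exact: integrable_translate (line_integrable _).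
Qed.

Lemma radon_translate (z : R * R) (t : R) :
  radon theta (fun x => phi (x - z)) t =
  radon theta phi (t - dotp (direction theta) z).
Proof.
rewrite /radon -[RHS](Rintegral_translate (z.2 * cos theta - z.1 * sin theta)).
  by apply: eq_Rintegral => s _; exact: (congr1 phi (line_translate z t s)).
exact: line_integrable.
Qed.

Lemma radon_shift_sum {Q : nat} (k : 'I_Q -> int * int) (c : 'I_Q -> R)
    (t : R) :
  radon theta (shift_sum phi k c) t =
  \sum_(l < Q) c l * radon_shift theta phi (k l) t.
Proof.
have Ik l := line_translate_integrable (zpoint (k l)) t.
rewrite /radon /Rintegral /shift_sum.
under eq_integral do rewrite -sumEFin.
rewrite integral_sum//=; last first.
  move=> l; under eq_fun do rewrite EFinM.
  by apply: integrableZl => //; exact: Ik.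
rewrite (eq_bigr (fun l => (c l * radon_shift theta phi (k l) t)%:E)).
  by rewrite sumEFin.
move=> l _; rewrite /radon_shift -radon_translate /radon.
rewrite EFinM fineK; last exact: integrable_fin_num (Ik l).
by rewrite -integralZl//; exact: Ik.
Qed.

End RadonRegularity.

(** * Linear algebra: good sample points, their stability, Gram matrices *)

(** The points are found one at a time. While there are [m < Q] of them, some nonzero [v] is
    orthogonal to all their rows; by independence the combination of the [g l] with coefficients [v]
    is nonzero at some [s] in [D], and the row at [s] is then outside the span of the others. *)
Lemma lin_indep_on_points {R : realType} (D : set R) (Q : nat)
    (g : 'I_Q -> R -> R) : lin_indep_on D g ->
  exists t : 'I_Q -> R, (forall i, D (t i)) /\
    \det (\matrix_(i < Q, l < Q) g l (t i)) != 0.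
Proof.
move=> indep.
suff : forall m, (m <= Q)%N -> exists t : 'I_m -> R, (forall i, D (t i)) /\
    row_free (\matrix_(i < m, l < Q) g l (t i)).
  move=> /(_ Q (leqnn Q))[t [Dt ft]]; exists t; split=> //.
  by rewrite -unitfE -unitmxE -row_free_unit.
elim=> [_|m IH mQ].
  exists (fun=> 0); split; first by case.
  by rewrite /row_free flatmx0 mxrank0.
have [t [Dt ft]] := IH (ltnW mQ).
set A := (\matrix_(i, l) _) in ft.
have kn0 : kermx A^T != 0.
  by rewrite -mxrank_eq0 mxrank_ker mxrank_tr (eqP ft) subn_eq0 -ltnNge.
have [v /sub_kermxP vA v0] := rowV0Pn kn0.
have [s [Ds sv]] : exists s, D s /\ \sum_(l < Q) v 0 l * g l s != 0.
  apply: contrapT => /forallNP nex; case/eqP: v0; apply/rowP => l.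
  rewrite mxE; apply: (indep (v 0)) => s Ds.
  by have := nex s => /not_andP[//|/negP]; rewrite negbK => /eqP.
exists (fun i => oapp t s (unlift ord0 i)); split.
  by move=> i; case: (unliftP ord0 i) => [j _|_] //=; exact: Dt.
apply: inj_row_free => u.
set M := (\matrix_(_, _) _) => uM.
have uMl l : u 0 ord0 * g l s + \sum_(i < m) u 0 (lift ord0 i) * A i l = 0.
  transitivity ((u *m M) 0 l); last by rewrite uM mxE.
  rewrite mxE big_ord_recl !mxE unlift_none /=; congr (_ + _).
  by apply: eq_bigr => i _; rewrite !mxE liftK.
have u0 : u 0 ord0 = 0.
  (* Pairing the relation [uMl] with [v] kills every old row and leaves only the new one. *)
  have : u 0 ord0 * (\sum_(l < Q) v 0 l * g l s) = 0.
    have AvT i : \sum_(l < Q) v 0 l * A i l = 0.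
      transitivity ((v *m A^T) 0 i); last by rewrite vA mxE.
      by rewrite mxE; apply: eq_bigr => l _; rewrite [in RHS]mxE.
    transitivity (\sum_(l < Q) v 0 l *
        (u 0 ord0 * g l s + \sum_(i < m) u 0 (lift ord0 i) * A i l));
      last first.
      by rewrite big1// => l _; rewrite uMl mulr0.
    under [RHS]eq_bigr do rewrite mulrDr.
    rewrite big_split /= [X in _ = _ + X](_ : _ = 0) ?addr0.
      by rewrite mulr_sumr; apply: eq_bigr => l _; rewrite mulrCA.
    under eq_bigr do rewrite mulr_sumr.
    rewrite exchange_big big1//= => i _.
    under eq_bigr do rewrite mulrCA.
    by rewrite -mulr_sumr AvT mulr0.
  by move/eqP; rewrite mulf_eq0 (negbTE sv) orbF => /eqP.
have uA : (\row_i u 0 (lift ord0 i)) *m A = 0.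
  apply/rowP => l; rewrite !mxE -[RHS](uMl l) u0 mul0r add0r.
  by apply: eq_bigr => i _; rewrite mxE.
have /rowP ul0 := row_free_inj ft (etrans uA (esym (mul0mx _ _))).
apply/rowP => i; rewrite mxE; case: (unliftP ord0 i) => [j ->|->] //.
by have := ul0 j; rewrite !mxE.
Qed.

Lemma det_neq0_near {R : realType} (Q : nat) (g : 'I_Q -> R -> R)
    (t : 'I_Q -> R) : (forall l, continuous (g l)) ->
  \det (\matrix_(i < Q, l < Q) g l (t i)) != 0 ->
  exists2 e : R, 0 < e & forall t' : 'I_Q -> R,
    (forall i, `|t i - t' i| < e) ->
    \det (\matrix_(i < Q, l < Q) g l (t' i)) != 0.
Proof.
move=> cg dt.
(* The points are packed into a row vector, whose sup-norm balls are exactly the condition on the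
   [t' i]; continuity of [F] is then read off the Leibniz formula. *)
pose F (v : 'rV[R]_Q) := \det (\matrix_(i < Q, l < Q) g l (v 0 i)).
have FE (t' : 'I_Q -> R) :
    \det (\matrix_(i < Q, l < Q) g l (t' i)) = F (\row_i t' i).
  by rewrite /F; congr determinant; apply/matrixP => i l; rewrite !mxE.
have cF : continuous F.
  have cP (s : 'S_Q) :
      continuous (fun v : 'rV[R]_Q => \prod_(i < Q) g (s i) (v 0 i)).
    apply: (@continuous_big R 'I_Q ( *%R) 1 xpredT (@mul_continuous _) _ _
      (fun i (v : 'rV[R]_Q) => g (s i) (v 0 i))) => i _ v.
    by apply: (continuous_comp (@coord_continuous _ _ _ _ _ _)); exact: cg.
  have -> : F =
      fun v => \sum_(s : 'S_Q) (-1) ^+ s * \prod_(i < Q) g (s i) (v 0 i).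
    apply/funext => v; apply: eq_bigr => s _.
    by congr (_ * _); apply: eq_bigr => i _; rewrite mxE.
  apply: (@continuous_big R {perm 'I_Q} (+%R) 0 xpredT (@add_continuous _) _ _
    (fun s (v : 'rV[R]_Q) =>
      (-1) ^+ s * \prod_(i < Q) g (s i) (v 0 i))) => s _ v.
  exact: (cvgM (cvg_cst _) (cP s v)).
rewrite FE in dt.
have : \forall v \near \row_i t i, F v != 0.
  have /cvgrPdist_lt/(_ `|F (\row_i t i)|) := cF (\row_i t i).
  rewrite normr_gt0 => /(_ dt); apply: filterS => v.
  by apply: contraTneq => ->; rewrite subr0 ltxx.
move=> /nbhs_ballP[e /= e0 He].
exists e => // t' tt'; rewrite FE; apply: He.
by split => // i j; rewrite !mxE; exact: tt'.
Qed.

(** If [v *m U^T *m U = 0], then [v *m U^T] has zero sum of squares, hence vanishes; its entries at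
    the indices [s i] already force [v = 0]. *)
Lemma gram_unitmx {R : realFieldType} (n Q : nat) (U : 'M[R]_(n, Q))
    (s : 'I_Q -> 'I_n) :
  \det (\matrix_(i < Q, l < Q) U (s i) l) != 0 -> U^T *m U \in unitmx.
Proof.
move=> ds; rewrite -row_free_unit; apply: inj_row_free => v vUU.
have : (v *m U^T) *m (v *m U^T)^T = 0.
  by rewrite trmx_mul trmxK !mulmxA -(mulmxA v) vUU mul0mx.
move/matrixP/(_ 0 0); rewrite mxE [RHS]mxE => /eqP.
under eq_bigr => j _ do rewrite [X in _ * X]mxE -expr2.
rewrite psumr_eq0 => [/allP vU|i _]; last exact: sqr_ge0.
have vU0 j : (v *m U^T) 0 j = 0.
  by apply/eqP; rewrite -sqrf_eq0; apply: vU; rewrite mem_index_enum.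
have := ds; rewrite -unitfE -det_tr -unitmxE -row_free_unit => fs.
apply: (row_free_inj fs); rewrite mul0mx; apply/rowP => i.
rewrite [RHS]mxE -[RHS](vU0 (s i)) !mxE.
by apply: eq_bigr => l _; rewrite !mxE.
Qed.

(** * Probability that the samples hit every box *)

Lemma measure_bigsetU_le {d} {T : measurableType d} {R : realType}
    (mu : {measure set T -> \bar R}) {I : Type} (s : seq I) (F : I -> set T) :
  (forall i, measurable (F i)) ->
  (mu (\big[setU/set0]_(i <- s) F i) <= \sum_(i <- s) mu (F i))%E.
Proof.
move=> mF; elim: s => [|i s IH]; first by rewrite !big_nil measure0.
rewrite !big_cons; apply: le_trans (leeD2l _ IH).
by apply: measureU2 => //; exact: bigsetU_measurable.
Qed.

(** Independence makes the probability of missing [B i] a product of [n] factors, each at most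
    [1 - q <= expR (- q)]; a union bound over the [Q] sets follows. *)
Lemma probability_hit_all {R : realType} {d} {T : measurableType d}
    (P : probability T R) (n : nat) (X : 'I_n -> {RV P >-> plane R})
    (Q : nat) (B : 'I_Q -> set (plane R)) (q : R) :
  independent_rvs X -> (forall i, measurable (B i)) ->
  (forall i j, (q%:E <= P (X j @^-1` B i))%E) ->
  with_probability_at_least P (1 - Q%:R * expR (- (n%:R * q)))
    [set w | forall i, exists j, B i (X j w)].
Proof.
move=> Xind mB qB.
have mXB j i : measurable (X j @^-1` B i).
  exact: measurable_funPTI.
pose miss i := \bigcap_(j in [set` [set: 'I_n]%SET]) (X j @^-1` ~` B i).
have mmiss i : measurable (miss i).
  apply: fin_bigcap_measurable; first exact: finite_finset.
  by move=> j _; rewrite preimage_setC; apply: measurableC; exact: mXB.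
have Pmiss i : (P (miss i) <= (expR (- (n%:R * q)))%:E)%E.
  rewrite /miss (Xind [set: 'I_n]%SET (fun=> ~` B i)); last first.
    by move=> _; apply: measurableC; exact: mB.
  rewrite (eq_bigr (fun j => (1 - fine (P (X j @^-1` B i)))%:E)); last first.
    move=> j _; rewrite preimage_setC probability_setC; last exact: mXB.
    rewrite EFinB fineK//.
    exact: fin_num_measure.
  rewrite prodEFin lee_fin.
  apply: (@le_trans _ _ (\prod_(j in [set: 'I_n]%SET) expR (- q))).
    apply: ler_prod => j _; apply/andP; split.
      rewrite subr_ge0 -lee_fin fineK; last exact: fin_num_measure.
      exact: probability_le1.
    apply: le_trans (expR_ge1Dx _); rewrite lerD2l lerN2 -lee_fin fineK//.
    exact: fin_num_measure.
  by rewrite prodr_const cardsT card_ord -expRM_natl mulrN.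
exists (~` \big[setU/set0]_(i < Q) miss i); split.
- by apply: measurableC; exact: bigsetU_measurable.
- move=> w; rewrite -bigcup_seq => /= nw i; apply: contrapT => nj.
  apply: nw; exists i; first exact: mem_index_enum.
  move=> j _ /= Bj.
  by apply: nj; exists j.
- rewrite probability_setC; last exact: bigsetU_measurable.
  rewrite EFinB leeB// (le_trans (measure_bigsetU_le _ _ _ mmiss))//.
  apply: (@le_trans _ _ (\sum_(i < Q) (expR (- (n%:R * q)))%:E)%E).
    by apply: lee_sum => i _; exact: Pmiss.
  by rewrite sumEFin lee_fin sumr_const card_ord -[leLHS]mulr_natl.
Qed.

(** * Areas of rectangles and bounds on the density *)

Lemma measurable_square {R : realType} (K : R) :
  measurable (square K : set (plane R)).
Proof.
rewrite (_ : square K = `[- K, K]%classic `*` `[- K, K]%classic).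
  by apply: measurableX; exact: measurable_itv.
by apply/seteqP; split => x /=; rewrite !in_itv.
Qed.

Lemma lebesgue2_rectangle {R : realType} (a1 b1 a2 b2 : R) :
  a1 <= b1 -> a2 <= b2 ->
  lebesgue2 R (`[a1, b1]%classic `*` `[a2, b2]%classic) =
  ((b1 - a1) * (b2 - a2))%:E.
Proof.
have itvE (a b : R) : a <= b ->
    @lebesgue_measure R `[a, b]%classic = (b - a)%:E.
  rewrite le_eqVlt lebesgue_measure_itv /= lte_fin => /predU1P[->|->].
    by rewrite ltxx subrr.
  by rewrite EFinB.
move=> ab1 ab2; rewrite product_measure1E; [|exact: measurable_itv..].
by rewrite EFinM; congr (_ * _)%E; exact: itvE.
Qed.

Section Density.
Context {R : realType} {d : measure_display} {T : measurableType d}.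
Context (P : probability T R) (K : R) (xi : R * R -> R).
Context (Y : {RV P >-> plane R}) (Yxi : has_density_on (square K) xi Y).

Lemma density_ge (m : R) (B : set (plane R)) : 0 <= m ->
  (forall x, square K x -> m <= xi x) -> measurable B -> B `<=` square K ->
  (m%:E * lebesgue2 R B <= P (Y @^-1` B))%E.
Proof.
move=> m0 mxi mB BK; have [mf /(_ _ mB)] := Yxi.
rewrite /distribution /pushforward => ->; rewrite setIidl//.
rewrite -integral_cst//; apply: ge0_le_integral => //.
  apply/measurable_EFinP.
  exact: (measurable_funS (measurable_square K) BK mf).
by move=> x Bx; rewrite lee_fin; apply: mxi; exact: BK.
Qed.

(** The total mass 1 is at most the upper bound of the density times the area of the square. *)
Lemma density_mass (m M : R) : 0 <= K -> 0 <= m ->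
  (forall x, square K x -> m <= xi x <= M) -> 1 <= M * (4 * K ^+ 2).
Proof.
move=> K0 m0 xib; have [mf /(_ setT measurableT)] := Yxi.
rewrite /distribution /pushforward preimage_setT probability_setT setTI => E1.
rewrite -lee_fin {}E1.
have -> : (M * (4 * K ^+ 2))%:E = (M%:E * lebesgue2 R (square K))%E.
  rewrite (_ : square K = `[- K, K]%classic `*` `[- K, K]%classic).
    rewrite lebesgue2_rectangle; [|lra..].
    by rewrite -EFinM; congr EFin; ring.
  by apply/seteqP; split => x /=; rewrite !in_itv.
rewrite -integral_cst; last exact: measurable_square.
apply: ge0_le_integral => //.
- exact: measurable_square.
- by move=> x /xib/andP[mx _]; rewrite lee_fin (le_trans m0).
- exact/measurable_EFinP.
- by move=> x /xib/andP[_ xM]; rewrite lee_fin.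
Qed.

End Density.

(** * Reconstruction formula, boxes in the square, and the exponent *)

(** The samples form the vector [U *m cv], and [invmx (U^T *m U) *m U^T] is a left inverse of [U],
    so it recovers the coefficients. *)
Lemma sample_reconstruction {R : realType} (N : R) (phi : R * R -> R)
    (theta : R) (Q : nat) (k : 'I_Q -> int * int) (n : nat)
    (x : 'I_n -> R * R) (c : 'I_Q -> R) (y : R * R) :
  continuous phi -> compact_support_in phi (square N) ->
  let U := sample_matrix theta phi k x in U^T *m U \in unitmx ->
  shift_sum phi k c y =
  \sum_(j < n) radon theta (shift_sum phi k c) (dotp (direction theta) (x j)) *
    Upsilon theta phi k x j y.
Proof.
move=> phi_cont phi_supp U uU.
pose cv : 'cV[R]_Q := \col_l c l.
pose pv : 'rV[R]_Q := \row_l phi (y - zpoint (k l)).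
have -> : shift_sum phi k c y = (pv *m cv) 0 0.
  by rewrite mxE; apply: eq_bigr => l _; rewrite !mxE mulrC.
have UpsE j : Upsilon theta phi k x j y =
    (pv *m ((invmx (U^T *m U))^T *m U^T)) 0 j.
  rewrite mxE /Upsilon; apply: eq_bigr => l _.
  rewrite !mxE mulr_sumr; apply: eq_bigr => i _.
  by rewrite !mxE; ring.
have radE j : radon theta (shift_sum phi k c) (dotp (direction theta) (x j)) =
    (U *m cv) j 0.
  rewrite (radon_shift_sum N)// mxE; apply: eq_bigr => l _.
  by rewrite !mxE mulrC.
transitivity ((pv *m ((invmx (U^T *m U))^T *m U^T) *m (U *m cv)) 0 0).
  (* The transpose of the inverse disappears because the Gram matrix is symmetric. *)
  rewrite -!mulmxA (mulmxA U^T) trmx_inv trmx_mul trmxK.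
  by rewrite (mulmxA (invmx _)) mulVmx// mul1mx.
by rewrite mxE; apply: eq_bigr => j _; rewrite UpsE radE mulrC.
Qed.

(* The homothety of ratio [1 - eta] towards a point of the square keeps a box
   of side [2 * eta * K] around it inside the square. *)
Lemma square_box {R : realType} (K eta : R) (x : R * R) :
  0 < K -> 0 < eta <= 1 -> square K x ->
  exists B : set (plane R), [/\ measurable B, B `<=` square K,
    lebesgue2 R B = ((2 * eta * K) ^+ 2)%:E &
    forall y, B y ->
      `|x.1 - y.1| <= 2 * eta * K /\ `|x.2 - y.2| <= 2 * eta * K].
Proof.
move=> K0 /andP[e0 e1] [x1K x2K].
pose I (a : R) : set (measurableTypeR R) :=
  `[(1 - eta) * a - eta * K, (1 - eta) * a + eta * K]%classic.
(* Here [|a - b| <= eta * |a| + eta * K]. *)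
have IK a b : - K <= a <= K -> I a b ->
    (- K <= b <= K) /\ `|a - b| <= 2 * eta * K.
  rewrite /I /= in_itv /= ler_norml => /andP[a1 a2] /andP[b1 b2].
  by split; apply/andP; split; nra.
exists (I x.1 `*` I x.2); split.
- by apply: measurableX; exact: measurable_itv.
- by move=> y [/(IK _ _ x1K)[? _] /(IK _ _ x2K)[? _]].
- rewrite lebesgue2_rectangle; [|nra..].
  by congr EFin; ring.
- by move=> y [/(IK _ _ x1K)[_ ?] /(IK _ _ x2K)[_ ?]].
Qed.

Lemma dotp_direction_le {R : realType} (theta : R) (x y : R * R) (r : R) :
  `|x.1 - y.1| <= r -> `|x.2 - y.2| <= r ->
  `|dotp (direction theta) x - dotp (direction theta) y| <= 2 * r.
Proof.
move=> h1 h2.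
rewrite (_ : _ - _ = cos theta * (x.1 - y.1) + sin theta * (x.2 - y.2));
  last first.
  by rewrite /dotp /direction /=; ring.
rewrite (le_trans (ler_normD _ _))// mulr_natl mulr2n !normrM.
apply: lerD; rewrite -[leRHS]mul1r ler_pM// ler_norml.
  by rewrite cos_geN1 cos_le1.
by rewrite sin_geN1 sin_le1.
Qed.

(* Only the summand [g * u * m2 ^+ 2 / 3] of the bracket is kept; what is left
   is linear in [g / u], and [1 / u <= 4 * K ^+ 2] as a density has mass 1. *)
Lemma exponent_le {R : realFieldType} (K Ct m2 M2 Cp l u g r : R) :
  0 < K -> 0 < Ct -> 0 < m2 -> 0 < M2 -> 0 < l -> 1 <= u * (4 * K ^+ 2) ->
  0 < g < 2 * K * (r ^+ 2 * Ct ^+ 2 * M2 ^+ 4 / (3 * K * m2 ^+ 2)) * l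
    / M2 ^+ 2 ->
  m2 ^+ 4 * g ^+ 2 /
    (8 * K ^+ 2 * Ct ^+ 2 * M2 ^+ 2 *
      (4 * K ^+ 2 * Ct ^+ 2 * Cp ^+ 2 * u + g * (Cp ^+ 2 + u * m2 ^+ 2) / 3))
  <= l * r ^+ 2.
Proof.
move=> K0 Ct0 m0 M0 l0 uK /andP[g0 gC].
have u0 : 0 < u.
  rewrite -(pmulr_lgt0 _ (_ : 0 < 4 * K ^+ 2)); first exact: lt_le_trans uK.
  by rewrite mulr_gt0// exprn_gt0.
(* In terms of [w] the upper bound on [g] reads [m2 ^+ 2 * g < 2 / 3 * w]. *)
set w := r ^+ 2 * Ct ^+ 2 * M2 ^+ 2 * l.
have w0 : 0 <= w by rewrite /w -!exprMn mulr_ge0 ?sqr_ge0 ?ltW.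
have gw : m2 ^+ 2 * g <= 2 / 3 * w.
  apply: ltW; rewrite mulrC -ltr_pdivlMr ?exprn_gt0//; apply: lt_le_trans gC _.
  rewrite le_eqVlt; apply/orP; left; apply/eqP; rewrite /w.
  by field; rewrite !gt_eqF.
have guw : m2 ^+ 2 * g <= 8 / 3 * K ^+ 2 * u * w by nra.
set D0 := 8 * K ^+ 2 * Ct ^+ 2 * M2 ^+ 2.
have D00 : 0 < D0 by rewrite !mulr_gt0// exprn_gt0.
have lowD : g * (u * m2 ^+ 2) / 3 <=
    4 * K ^+ 2 * Ct ^+ 2 * Cp ^+ 2 * u + g * (Cp ^+ 2 + u * m2 ^+ 2) / 3.
  rewrite (mulrDr g) mulrDl addrA lerDr addr_ge0//.
    apply: mulr_ge0; last exact: ltW.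
    by rewrite -mulrA -exprMn -mulrA -exprMn mulr_ge0 ?sqr_ge0.
  by apply: divr_ge0 => //; rewrite mulr_ge0 ?sqr_ge0 ?ltW.
have bot0 : 0 < g * (u * m2 ^+ 2) / 3.
  by rewrite !mulr_gt0// ?exprn_gt0// invr_gt0.
rewrite ler_pdivrMr; last by rewrite mulr_gt0// (lt_le_trans bot0).
(* Both sides contain the factor [m2 ^+ 2 * g]; once it is cancelled, [guw] remains. *)
apply: (@le_trans _ _ (l * r ^+ 2 * (D0 * (g * (u * m2 ^+ 2) / 3)))).
  rewrite [leLHS](_ : _ = m2 ^+ 2 * g * (m2 ^+ 2 * g)); last by ring.
  rewrite [leRHS](_ : _ = m2 ^+ 2 * g * (8 / 3 * K ^+ 2 * u * w)).
    by rewrite ler_pM2l// mulr_gt0// exprn_gt0.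
  by rewrite /w /D0; field.
apply: ler_wpM2l; first by rewrite mulr_ge0 ?sqr_ge0 ?ltW.
by rewrite ler_pM2l.
Qed.

(** * Choice of the boxes and of the constants *)

Theorem theorem4p2 (R : realType) (N K : R) (hN : 0 < N) (hK : 0 < K)
  (Q : nat) (k : 'I_Q -> int * int)
  (hk : set_bij [set: 'I_Q] (shift_set N K) k) (hQ : (1 < Q)%N)
  (phi : R * R -> R) (phi_cont : continuous phi)
  (phi_supp : compact_support_in phi (square N))
  (m2 M2 : R) (hm2 : 0 < m2) (hmM : m2 <= M2)
  (hstable : stable_shifts K phi k m2 M2)
  (theta : R) (htheta : 0 <= theta < pi / 2)
  (hindep : lin_indep_on [set dotp (direction theta) x | x in square K]
              (fun l => radon_shift theta phi (k l))) :
  exists C1 C2 : R, [/\ 0 < C1, C1 <= C2 &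
    forall (d : measure_display) (T : measurableType d) (P : probability T R)
      (n : nat) (X : 'I_n -> {RV P >-> plane R})
      (xi : R * R -> R) (Cxil Cxiu : R),
      independent_rvs X ->
      (forall j, has_density_on (square K) xi (X j)) ->
      0 < Cxil ->
      (forall x, square K x -> Cxil <= xi x <= Cxiu) ->
      forall gamma : R, 0 < gamma < 2 * K * C1 * Cxil / M2 ^+ 2 ->
      with_probability_at_least P
        (1 - epsilonQ Q n K (cos theta + sin theta) m2 M2 (Cphi K phi k)
               Cxiu gamma)
        [set w |
          let x := fun j => X j w in
          let U := sample_matrix theta phi k x in
          U^T *m U \in unitmx /\
          forall f, signal_space K phi k f ->
          forall c, represents K phi k c f ->
          forall y, square K y ->
            f y = \sum_(j < n)
                    radon theta (shift_sum phi k c)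
                      (dotp (direction theta) (x j)) *
                    Upsilon theta phi k x j y]].
Proof.
have M20 : 0 < M2 := lt_le_trans hm2 hmM.
have Ct0 : 0 < cos theta + sin theta.
  have [t0 tpi] := andP htheta.
  apply: ltr_wpDr.
    apply: sin_ge0_pi; rewrite t0/= (le_trans (ltW tpi))// ler_pdivrMr//.
    by have := pi_ge0 R; lra.
  by apply: cos_gt0_pihalf; rewrite tpi andbT; have := pi_gt0 R; lra.
have cg l : continuous (radon_shift theta phi (k l)).
  move=> t; apply: (continuous_comp (f := fun t => t - _)).
    by apply: cvgB; [exact: cvg_id|exact: cvg_cst].
  exact: (radon_continuous N).
have [t [Dt dett]] := lin_indep_on_points _ _ _ hindep.
have [e e0 near_t] := det_neq0_near _ _ _ cg dett.
have /choice[x_ xt] i : exists x, square K x /\ dotp (direction theta) x = t i.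
  by have [x Kx xt] := Dt i; exists x.
(* The cap 1 keeps the boxes inside the square; the other term gives [2 * r = 4 * eta * K <= e / 2],
   as a box of side [r] moves the projection by at most [2 * r]. *)
pose eta := Num.min 1 (e / (8 * K)).
have eta01 : 0 < eta <= 1.
  by rewrite /eta lt_min ltr01 divr_gt0 ?mulr_gt0//= ge_min lexx.
pose r := 2 * eta * K.
have re : 2 * r < e.
  have : eta * (8 * K) <= e.
    by rewrite -ler_pdivlMr ?mulr_gt0// ge_min lexx orbT.
  by rewrite /r; lra.
have /choice[B BP] i := square_box K eta (x_ i) hK eta01 (xt i).1.
(* This is the value for which [exponent_le] bounds the exponent by [l * r ^+ 2] per sample. It
   depends on neither the density nor [n]. *)
pose C1 := r ^+ 2 * (cos theta + sin theta) ^+ 2 * M2 ^+ 4 / (3 * K * m2 ^+ 2).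
have [eta0 _] := andP eta01.
have r0 : 0 < r by rewrite /r !mulr_gt0.
exists C1, C1; split=> //.
  by apply: divr_gt0; rewrite !(exprn_gt0, mulr_gt0).
move=> d T P n X xi l u Xind Xxi l0 xilu gamma hgamma.
have hitp i j : ((l * r ^+ 2)%:E <= P (X j @^-1` B i))%E.
  have [mB BK volB _] := BP i.
  rewrite EFinM -volB; apply: (density_ge _ _ _ _ (Xxi j)) => //.
    exact: ltW.
  by move=> x /xilu /andP[].
have [] := probability_hit_all P n X Q B (l * r ^+ 2) Xind _ hitp.
  by move=> i; have [] := BP i.
move=> A [mA Ahit PA]; exists A; split=> //.
- move=> w /Ahit/= /choice[s hs].
  set U := sample_matrix _ _ _ _.
  have uU : U^T *m U \in unitmx.
    (* The sample [s i] lies in [B i], so its projection is within [e] of [t i] and the minor on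
       these rows is nonzero. *)
    apply: (gram_unitmx _ _ _ s).
    have := near_t (fun i => dotp (direction theta) (X (s i) w)).
    rewrite (_ : (\matrix_(_, _) _) = \matrix_(i, m) U (s i) m); last first.
      by apply/matrixP => i m; rewrite !mxE.
    apply=> i; rewrite -(xt i).2; have [_ _ _ /(_ _ (hs i))[h1 h2]] := BP i.
    exact: le_lt_trans (dotp_direction_le _ _ _ _ h1 h2) re.
  split=> // f _ c fc y Ky; rewrite fc//.
  exact: (sample_reconstruction N).
- apply: le_trans PA; rewrite lee_fin lerD2l lerN2 /epsilonQ ler_wpM2l//.
  rewrite ler_expR lerN2; set D := 8 * _ * _ * _ * _.
  rewrite (_ : _ / D = n%:R * (m2 ^+ 4 * gamma ^+ 2 / D)); last first.
    by rewrite !mulrA.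
  (* The mass bound on the density is drawn from a sample, so [n = 0] is treated apart; both
     exponents are then 0. *)
  have [n0|n0] := posnP n; first by rewrite n0 !mul0r.
  rewrite ler_wpM2l//; apply: exponent_le => //.
  exact: (density_mass _ _ _ _ (Xxi (Ordinal n0)) _ _ (ltW hK) (ltW l0) xilu).
Qed.
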